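(* Let $\mathbf{c}=(c_1,\dots,c_n)$ be a tuple of positive integers and let $C=\sum_{i=1}^n c_i$. Then the characteristic polynomial of the asymmetric $\mathbf{c}$-Shi arrangement $\mathcal{A}_{\mathrm{Shi}}^{\mathbf{c}}$ in $\mathbb{R}^n$ is $$\chi(\mathcal{A}_{\mathrm{Shi}}^{\mathbf{c}},q)=q(q-C)^{n-1}.$$ Moreover, the number of regions of $\mathcal{A}_{\mathrm{Shi}}^{\mathbf{c}}$ is $$r(\mathcal{A}_{\mathrm{Shi}}^{\mathbf{c}})=(1+C)^{n-1}.$$
   Context: Notation: $[n]=\{1,\dots,n\}$; for integers $a\le b$, $[a,b]=\{a,a+1,\dots,b\}$. For each $i\in[n]$ put $m_i=(c_i+1)/2$ if $c_i$ is odd and $m_i=c_i/2$ if $c_i$ is even. Let $I=\{i\in[n] : c_i \text{ is odd}\}$ and let $\mathbf{1}_I$ be its indicator function. Asymmetric $\mathbf{c}$-Shi arrangement: the finite collection $\mathcal{A}_{\mathrm{Shi}}^{\mathbf{c}}$ of all affine hyperplanes $\{x\in\mathbb{R}^n : x_i-x_j=k\}$ with $1\le i<j\le n$ and $k\in[-m_i-m_j+1+\mathbf{1}_I(i),\; m_i+m_j-\mathbf{1}_I(j)]$. For a hyperplane arrangement $\mathcal{A}$ in $\mathbb{R}^n$, $L(\mathcal{A})$ is the poset of all nonempty intersections of hyperplanes of $\mathcal{A}$ ordered by reverse inclusion, with minimum $\hat0=\mathbb{R}^n$ (the empty intersection); the characteristic polynomial is $\chi(\mathcal{A},q)=\sum_{x\in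 L(\mathcal{A})}\mu(\hat0,x)q^{\dim x}$, where $\mu$ is the Möbius function of $L(\mathcal{A})$. A region of $\mathcal{A}$ is a connected component of $\mathbb{R}^n\setminus\bigcup_{H\in\mathcal{A}}H$, and $r(\mathcal{A})$ is the number of regions. *)

(* Defs.v *)
From HB Require Import structures.
From mathcomp Require Import all_boot all_order all_algebra finmap.
From mathcomp Require Import all_classical all_reals all_analysis.

Set Implicit Arguments.
Unset Strict Implicit.
Unset Printing Implicit Defensive.

Import Order.TTheory GRing.Theory Num.Theory.
Import numFieldNormedType.Exports.

Local Open Scope classical_set_scope.
Local Open Scope ring_scope.

Section Mobius.
Variables (d : Order.disp_t) (P : finPOrderType d).
Implicit Types x y z : P.

(* [k] only bounds the depth of the recursion; any bound that is at least the
   length of the longest chain gives the same value, see [mobiusE]. *)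
Fixpoint mobius_rec (k : nat) x y : int :=
  if x == y then 1 else
  if k is k'.+1 then
    if (x < y)%O then - \sum_(z | (x <= z < y)%O) mobius_rec k' x z else 0
  else 0.

Definition mobius x y : int := mobius_rec #|P| x y.

Lemma mobius_rec_stable k l x y :
  (#|[pred z | z < y]%O| <= k)%N -> (#|[pred z | z < y]%O| <= l)%N ->
  mobius_rec k x y = mobius_rec l x y.
Proof.
elim: k l y => [|k IHk] [|l] y //=.
- rewrite leqn0 => /eqP/card0_eq y0 _; case: eqP => // _.
  by have := y0 x; rewrite !inE => ->.
- rewrite leqn0 => _ /eqP/card0_eq y0; case: eqP => // _.
  by have := y0 x; rewrite !inE => ->.
move=> yk yl; case: eqP => // _; case: ifP => // _.
congr (- _); apply: eq_bigr => z /andP[_ zy].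
have lt_zy : (#|[pred t | t < z]%O| < #|[pred t | t < y]%O|)%N.
  apply/proper_card/properP; split.
    by apply/fintype.subsetP => t; rewrite !inE => /lt_trans; apply.
  by exists z; rewrite !inE ?ltxx.
by apply: IHk; rewrite -ltnS (leq_trans lt_zy).
Qed.

Lemma mobiusE x y : mobius x y =
  if x == y then 1 else
  if (x < y)%O then - \sum_(z | (x <= z < y)%O) mobius x z else 0.
Proof.
rewrite {1}/mobius (@mobius_rec_stable _ #|P|.+1) ?max_card//.
by rewrite ltnW// ltnS max_card.
Qed.

End Mobius.

Section Arrangement.
Variables (R : realType) (n : nat).
Local Notation V := 'rV[R]_n.

(* An arrangement is a finite set of subsets of R^n. Nothing below forces
   these to be hyperplanes. *)
Implicit Types A B : {fset set V}.

(* The subfamily B = fset0 contributes the whole space. *)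
Definition flats A : {fset set V} :=
  [fset X in [fset (\bigcap_(H in [set` B]) H : set V) |
      B : {fset set V} in fpowerset A] | X != set0]%fset.

Lemma flatsP A (X : set V) : X \in flats A <->
  X !=set0 /\ exists2 B : {fset set V}, (B `<=` A)%fset &
    X = \bigcap_(H in [set` B]) H.
Proof.
rewrite !inE /=; split.
  move=> /andP[/imfsetP[B /= BA ->]] /set0P X0; split=> //.
  by exists B; rewrite // -fpowersetE.
move=> [X0 [B BA XB]]; apply/andP; split; last exact/set0P.
by apply/imfsetP; exists B; rewrite //= fpowersetE.
Qed.

Lemma setT_flat A : [set: V] \in flats A.
Proof.
apply/flatsP; split; first by exists 0.
exists fset0; first exact: fsub0set.
by apply/seteqP; split=> // x _ H /=; rewrite inE.
Qed.

Definition intersection_poset A : Type := flats A.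

HB.instance Definition _ A := Finite.on (intersection_poset A).

Fact intersection_display : Order.disp_t.
Proof. exact: Order.default_display. Qed.

Section IntersectionPoset.
Variable A : {fset set V}.
Implicit Types X Y : intersection_poset A.

Definition flat_le X Y : bool := `[< fsval Y `<=` fsval X >].

Fact flat_le_refl : reflexive flat_le.
Proof. by move=> X; apply/asboolP. Qed.

Fact flat_le_anti : antisymmetric flat_le.
Proof.
move=> X Y /andP[/asboolP YX /asboolP XY].
by apply: val_inj; apply/seteqP.
Qed.

Fact flat_le_trans : transitive flat_le.
Proof.
move=> X Y Z /asboolP XY /asboolP ZX; apply/asboolP.
exact: subset_trans ZX XY.
Qed.

HB.instance Definition _ := Order.Le_isPOrder.Build intersection_display
  (intersection_poset A) flat_le_refl flat_le_anti flat_le_trans.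

Definition whole_flat : intersection_poset A := [` setT_flat A]%fset.

Fact flat_le0x X : (whole_flat <= X)%O.
Proof. exact/asboolP. Qed.

HB.instance Definition _ := Order.hasBottom.Build intersection_display
  (intersection_poset A) flat_le0x.

End IntersectionPoset.

Definition translate (p : V) (W : {vspace V}) : set V :=
  [set x | x - p \in W].

(* Dimension of an affine subspace, i.e. of its direction; the value on sets
   that are not affine subspaces is irrelevant. *)
Definition affine_dim (X : set V) : nat :=
  \dim (xget 0%VS [set W : {vspace V} | exists p, X = translate p W]).

Lemma affine_dim_translate p W : affine_dim (translate p W) = \dim W.
Proof.
rewrite /affine_dim; case: xgetP => [W' _ [q pq]|/(_ W)]; last first.
  by case; exists p.
have memE x : (x - p \in W) = (x - q \in W').
  have e : (x - p \in W : Prop) = (x - q \in W') := congr1 (@^~ x) pq.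
  by apply/idP/idP; rewrite e.
congr (\dim _); apply/vspaceP => v.
have pqW' : p - q \in W' by rewrite -memE subrr mem0v.
by rewrite -[in RHS](addrK p v) memE -addrA rpredDr.
Qed.

Definition char_polynomial A : {poly int} :=
  \sum_(X : intersection_poset A)
    mobius \bot%O X *: 'X^(affine_dim (fsval X)).

Definition regions A : set (set V) :=
  let U := ~` (\bigcup_(H in [set` A]) H) in
  [set connected_component U x | x in U].

End Arrangement.

Section Shi.
Variables (R : realType) (n : nat) (c : 'I_n -> nat).

Definition shi_m (i : 'I_n) : nat :=
  if odd (c i) then (c i).+1./2 else (c i)./2.

Definition shi_lo (i j : 'I_n) : int :=
  - (shi_m i)%:Z - (shi_m j)%:Z + 1 + (odd (c i))%:Z.

Definition shi_hi (i j : 'I_n) : int :=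
  (shi_m i)%:Z + (shi_m j)%:Z - (odd (c j))%:Z.

Definition diff_hyperplane (i j : 'I_n) (k : int) : set 'rV[R]_n :=
  [set x | x ord0 i - x ord0 j = k%:~R].

Definition shi_set : set (set 'rV[R]_n) :=
  [set H | exists (i j : 'I_n) (k : int),
    [/\ (i < j)%N, shi_lo i j <= k <= shi_hi i j & H = diff_hyperplane i j k]].

Lemma finite_shi_set : finite_set shi_set.
Proof.
pose f (t : 'I_n * 'I_n * nat) :=
  diff_hyperplane t.1.1 t.1.2 (shi_lo t.1.1 t.1.2 + t.2%:Z).
pose N := (\max_(t : 'I_n * 'I_n) `|shi_hi t.1 t.2 - shi_lo t.1 t.2|)%N.
apply: (@sub_finite_set _ _ (f @` (setT `*` `I_N.+1))); last first.
  by apply: finite_image; apply: finite_setX; [exact: finite_finset|].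
move=> _ [i [j [k [_ /andP[lok khi] ->]]]].
have k0 : 0 <= k - shi_lo i j by rewrite subr_ge0.
exists ((i, j), `|k - shi_lo i j|%N); last first.
  by rewrite /f /= gez0_abs// [X in diff_hyperplane _ _ X]addrC subrK.
split=> //=; rewrite ltnS.
apply: (@leq_trans `|shi_hi i j - shi_lo i j|%N).
  rewrite -lez_nat !gez0_abs ?lerB//.
  by rewrite subr_ge0 (le_trans lok).
exact: (@leq_bigmax _
  (fun t : 'I_n * 'I_n => `|shi_hi t.1 t.2 - shi_lo t.1 t.2|%N) (i, j)).
Qed.

Definition shi_arrangement : {fset set 'rV[R]_n} := fset_set shi_set.

Lemma mem_shi_arrangement H : H \in shi_arrangement <-> shi_set H.
Proof. by rewrite in_fset_set ?inE//; exact: finite_shi_set. Qed.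

End Shi.

(* Main.v *)
From HB Require Import structures.
Require Import Defs.
From mathcomp Require Import all_boot all_order all_algebra finmap.
From mathcomp Require Import all_classical all_reals all_analysis.
From mathcomp Require Import zify ring lra.

Set Implicit Arguments.
Unset Strict Implicit.
Unset Printing Implicit Defensive.

Import Order.TTheory GRing.Theory Num.Theory.
Import numFieldNormedType.Exports.

Local Open Scope classical_set_scope.
Local Open Scope ring_scope.

(* By Whitney's theorem, chi(A) is the alternating sum of q^(dim cap B) over the
   central subfamilies B of A, that is, the result of iterating
   deletion-restriction on the whole space. Every intersection of hyperplanes
   x_i - x_j = k is a system x_l = x_(f l) + g_l with f idempotent, so it has as
   many points modulo q as q^dim; hence for every large q (prime or not)
   chi(A)(q) counts the points of (Z/q)^n on no hyperplane. The number of cells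
   cut out by A satisfies the deletion-restriction recursion too, up to sign,
   which gives r(A) = (-1)^n chi(A)(-1).
   Modulo q, a point avoids the Shi hyperplanes iff the arcs of length c_i placed
   around the x_i are disjoint and two arcs that touch have increasing indices.
   There are q - C uncovered cells; once the arc of the first index is fixed, the
   configuration amounts to an arbitrary function from the other indices to these
   cells, which tells after which uncovered cell each arc comes. *)

(** * Iterated deletion-restriction and Whitney's theorem *)

(** Unfolds to the sum, over the sublists B of [S], of (-1)^|B| times [phi] of the intersection of
    [F] with the members of B. *)
Fixpoint delres (V : Type) (Z : zmodType) (phi : set V -> Z) (F : set V)
    (S : seq (set V)) : Z :=
  if S is H :: S' then delres phi F S' - delres phi (F `&` H) S' else phi F.

Section Delres.
Variables V : choiceType.
Implicit Types (F H X Y : set V) (S : seq (set V)).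

Lemma delres_eq (Z : zmodType) (P : set V -> Prop) (phi psi : set V -> Z) F S :
  P F -> (forall X H, P X -> H \in S -> P (X `&` H)) ->
  (forall X, P X -> phi X = psi X) -> delres phi F S = delres psi F S.
Proof.
move=> + + eP; elim: S F => [|H S IH] F PF PS /=; first exact: eP.
have PS' X H' : P X -> H' \in S -> P (X `&` H').
  by move=> PX H'S; apply: PS; rewrite // inE H'S orbT.
by congr (_ - _); apply: IH => //; apply: PS => //; rewrite inE eqxx.
Qed.

Lemma delres_sum (Z : zmodType) (I : finType) (P : pred I)
    (phi : I -> set V -> Z) F S :
  delres (fun X => \sum_(i | P i) phi i X) F S =
  \sum_(i | P i) delres (phi i) F S.
Proof.
by elim: S F => [|H S IH] F //=; rewrite !IH -sumrB.
Qed.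

Lemma delres_morph (Z Z' : zmodType) (u : Z -> Z') (phi : set V -> Z) F S :
  {morph u : x y / x - y} ->
  delres (fun X => u (phi X)) F S = u (delres phi F S).
Proof. by move=> uB; elim: S F => [|H S IH] F //=; rewrite !IH uB. Qed.

Lemma delres_set0 (Z : zmodType) (phi : set V -> Z) S :
  phi set0 = 0 -> delres phi set0 S = 0.
Proof. by move=> p0; elim: S => [|H S IH] //=; rewrite set0I subrr. Qed.

(** Only sublists whose members all contain [X] contribute, and their signs cancel in pairs as soon
    as one member of [S] contains [X]. *)
Lemma delres_sub X F S :
  delres (fun Y => `[< X `<=` Y >]%:R : int) F S =
  (`[< X `<=` F >] && ~~ has (fun H => `[< X `<=` H >]) S)%:R.
Proof.
elim: S F => [|H S IH] F /=; first by rewrite andbT.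
rewrite !IH; have -> : `[< X `<=` F `&` H >] = `[< X `<=` F >] && `[< X `<=` H >].
  apply/asboolP/andP; first by rewrite subsetI => -[/asboolP ? /asboolP ?].
  by move=> [/asboolP ? /asboolP ?]; rewrite subsetI.
by case: `[< X `<=` F >]; case: `[< X `<=` H >]; case: has.
Qed.
End Delres.

Section Whitney.
Variables (R : realType) (n : nat).
Local Notation V := 'rV[R]_n.
Variables (A : {fset set V}) (S : seq (set V)).
Hypotheses (AS : A =i S) (ATn : setT \notin A).
Implicit Types X Y : intersection_poset A.

(** The recursion also meets empty intersections, which are not flats; hence the condition
    [phi set0 = 0] further on. *)
Let reached (Y : set V) := Y = set0 \/ Y \in flats A.

Let reachedI (Y H : set V) : reached Y -> H \in S -> reached (Y `&` H).
Proof.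
move=> [->|/flatsP[_ [B BA YB]]] HS; first by left; rewrite set0I.
have [->|/set0P Y0] := eqVneq (Y `&` H) set0; first by left.
right; apply/flatsP; split => //.
exists (H |` B)%fset; first by rewrite fsubUset fsub1set AS HS.
rewrite YB setIC; apply/seteqP; split=> [x [Hx Bx] K /=|x xK].
  by rewrite in_fset1U => /orP[/eqP->|]//; apply: Bx.
by split; [apply: xK; rewrite /= fset1U1|move=> K KB; apply: xK; rewrite /= fset1Ur].
Qed.

Let reachedT : reached setT.
Proof. by right; apply: setT_flat. Qed.

(** The signed number of sublists of [S] with intersection exactly [X]; grouping by intersection
    turns [delres] into a sum over flats. *)
Let nu (X : set V) : int := delres (fun Y : set V => (Y == X)%:R) setT S.

Let delres_nu (Z : lmodType int) (phi : set V -> Z) : phi set0 = 0 ->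
  delres phi setT S = \sum_(X : intersection_poset A) nu (fsval X) *: phi (fsval X).
Proof.
move=> phi0.
rewrite (@delres_eq _ _ reached _
  (fun Y : set V => \sum_(X : intersection_poset A) (Y == fsval X)%:R *: phi (fsval X)))//.
  rewrite delres_sum; apply: eq_bigr => X _.
  exact: (delres_morph (u := fun a => a *: phi (fsval X)) _ _ _ (fun a b => scalerBl a b _)).
move=> Y [->|YA].
  rewrite phi0 big1// => X _; case: eqP => [X0|]; last by rewrite scale0r.
  by rewrite -X0 phi0 scaler0.
rewrite (bigD1 ([` YA]%fset : intersection_poset A))//= eqxx scale1r.
rewrite big1 ?addr0// => X XY; case: eqP => [YX|]; last by rewrite scale0r.
by case/negP: XY; apply/eqP/val_inj.
Qed.

(* Summing over the flats Y above X leaves the alternating sum over the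
   subfamilies of the hyperplanes containing X. *)
Let sum_nu X : \sum_(Y | (Y <= X)%O) nu (fsval Y) = (X == \bot%O)%:R.
Proof.
have X0 : fsval X !=set0 by have /flatsP[] := fsvalP X.
transitivity (delres (fun Y : set V => `[< fsval X `<=` Y >]%:R : int^o) setT S).
  rewrite delres_nu; last first.
    by case: asboolP => //; rewrite subset0 => X00; case: X0; rewrite X00 => ? [].
  rewrite big_mkcond/=; apply: eq_bigr => Y _.
  rewrite [in LHS]/Order.le /= /flat_le.
  by case: ifP; rewrite ?scaler0//= [LHS](esym (mulr1 _)).
rewrite delres_sub; congr (_%:R); rewrite (_ : `[< _ `<=` setT >] = true) /=; last exact/asboolP.
congr nat_of_bool; apply/idP/eqP => [hS|->].
  apply: val_inj => /=.
  have /flatsP[_ [B BA XB]] := fsvalP X.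
  rewrite XB; apply/seteqP; split => // x _ H /= HB.
  case/hasP: hS; exists H; first by rewrite -AS (fsubsetP BA).
  by apply/asboolP; rewrite XB => y; apply.
apply/hasPn => H; rewrite -AS => HA; apply/negP => /asboolP TH.
by case/negP: ATn; rewrite (_ : setT = H)//; apply/seteqP; split.
Qed.

(** By [sum_nu], [nu] satisfies the recursion that defines the Möbius function; strong induction on
    the number of flats below [X]. *)
Let nuE X : mobius \bot%O X = nu (fsval X).
Proof.
have [k] := ubnP #|[pred z | (z < X)%O]|; elim: k X => // k IH X Xk.
rewrite mobiusE; have := sum_nu X; rewrite (bigD1 X)//= eq_sym.
rewrite (eq_bigl (fun z => (\bot <= z < X)%O)); last first.
  by move=> z; rewrite le0x /= lt_neqAle andbC.
have -> : \sum_(z | (\bot <= z < X)%O) nu (fsval z) =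
    \sum_(z | (\bot <= z < X)%O) mobius \bot%O z.
  apply: eq_bigr => z /andP[_ zX]; rewrite IH//.
  rewrite -ltnS; apply: leq_trans Xk; rewrite ltnS.
  apply/proper_card/properP; split.
    by apply/fintype.subsetP => t; rewrite !inE => /lt_trans; apply.
  by exists z; rewrite !inE ?ltxx.
case: eqP => [<-|/eqP X0].
  rewrite big_pred0 ?addr0// => z; apply/negP => /andP[bz zb].
  by have := le_lt_trans bz zb; rewrite ltxx.
rewrite lt0x eq_sym X0 => /eqP; rewrite addrC addr_eq0 => /eqP ->.
by rewrite opprK.
Qed.

Lemma char_polynomial_delres : char_polynomial A =
  delres (fun X : set V => if X == set0 then 0 else 'X^(affine_dim X)) setT S.
Proof.
rewrite delres_nu ?eqxx//; apply: eq_bigr => X _; rewrite nuE.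
by case: eqP => // X0; have /flatsP[/set0P/eqP] := fsvalP X.
Qed.
End Whitney.

(** * Intersections of the hyperplanes x_i - x_j = k *)

Section Potentials.
Variable n : nat.
Implicit Types (f : 'I_n -> 'I_n) (g : 'I_n -> int) (i j l : 'I_n) (k : int).

(* [f] sends every index to the root of its class and [x l - x (f l) = g l]. *)
Definition rooted f g := forall l, f (f l) = f l /\ g (f l) = 0.

Definition root_nodes f : pred 'I_n := [pred l | f l == l].

(** Over any ring, so that one system stands both for a real flat and for its reduction modulo q. *)
Definition potential (Z : comNzRingType) f g (x : 'I_n -> Z) : bool :=
  [forall l, x l == x (f l) + (g l)%:~R].

(* Imposing [x i - x j = k] hangs the class of [i] below the root of [j]. *)
Definition merge_root f i j l := if f l == f i then f j else f l.

Definition merge_shift f g i j k l : int :=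
  if f l == f i then g l + (k + g j - g i) else g l.

Lemma rooted_merge f g i j k : rooted f g -> f i != f j ->
  rooted (merge_root f i j) (merge_shift f g i j k).
Proof.
move=> fg ij l; rewrite /merge_root /merge_shift.
have [e|ne] := eqVneq (f l) (f i).
  by have [-> ->] := fg j; rewrite eq_sym (negbTE ij).
by have [-> ->] := fg l; rewrite (negbTE ne).
Qed.

Lemma card_roots_merge f g i j : rooted f g -> f i != f j ->
  #|root_nodes f| = #|root_nodes (merge_root f i j)|.+1.
Proof.
move=> fg ij; rewrite (cardD1 (f i)) !inE (fg i).1 eqxx add1n; congr _.+1.
apply: eq_card => l; rewrite !inE /merge_root.
have [e|ne] := eqVneq (f l) (f i); last first.
  by have [e|] := eqVneq l (f i) => //=; rewrite e (fg i).1 eqxx in ne.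
rewrite e eq_sym andNb; apply/esym/negbTE; apply: contra ij => /eqP jl.
by rewrite -e -jl (fg j).1.
Qed.

Lemma potential_merge (Z : comNzRingType) f g i j k (x : 'I_n -> Z) :
  rooted f g -> f i != f j ->
  potential (merge_root f i j) (merge_shift f g i j k) x =
  potential f g x && (x i - x j == k%:~R).
Proof.
move=> fg ij; apply/forallP/andP => [fx|[/forallP fx /eqP xij] l].
  have xi : x (f i) = x (f j) + (k + g j - g i)%:~R.
    have /eqP := fx (f i); rewrite /merge_root /merge_shift (fg i).1 eqxx.
    by rewrite (fg i).2 add0r.
  have fx' l : x l = x (f l) + (g l)%:~R.
    have /eqP := fx l; rewrite /merge_root /merge_shift.
    have [-> ->|//] := eqVneq (f l) (f i).
    by rewrite xi -!addrA -intrD; congr (_ + _%:~R); ring.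
  split; first by apply/forallP => l; apply/eqP.
  by rewrite [x i]fx' [x j]fx' xi; apply/eqP; ring.
rewrite /merge_root /merge_shift.
have [e|ne] := eqVneq (f l) (f i); last exact: fx.
have /eqP xl := fx l; have /eqP xi := fx i; have /eqP xj := fx j.
apply/eqP; rewrite xl e; have -> : x (f i) = x i - (g i)%:~R by rewrite xi addrK.
have -> : x i = k%:~R + x j by rewrite -xij subrK.
by rewrite xj; ring.
Qed.

(** Indices with the same root have a constant difference, so over the reals a further equation
    between them is either redundant or contradictory. *)
Lemma potential_unmerged (Z : comNzRingType) f g i j k (x : 'I_n -> Z) :
  potential f g x -> f i = f j -> x i - x j - k%:~R = (g i - g j - k)%:~R.
Proof.
move=> /forallP fx ij; rewrite (eqP (fx i)) (eqP (fx j)) ij; ring.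
Qed.
End Potentials.

(** * Size modulo q and real dimension of a rooted system *)

Section Counting.
Variables (n : nat) (q : nat).
Hypothesis q_gt1 : (1 < q)%N.
(** The values at the roots are free and determine the others; [h] is the resulting
    parametrisation. *)
Lemma card_potential (f : 'I_n -> 'I_n) (g : 'I_n -> int) : rooted f g ->
  #|[set x : {ffun 'I_n -> 'Z_q} | potential f g x]%SET| = (q ^ #|root_nodes f|)%N.
Proof.
move=> fg; pose D := {l : 'I_n | f l == l}.
pose r l : D := exist _ (f l) (introT eqP (fg l).1).
pose h (y : {ffun D -> 'Z_q}) : {ffun 'I_n -> 'Z_q} :=
  [ffun l => y (r l) + (g l)%:~R].
have hE (y : {ffun D -> 'Z_q}) (d : D) : h y (val d) = y d.
  rewrite ffunE; have e := eqP (valP d).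
  have -> : g (val d) = 0 by rewrite -e (fg _).2.
  by rewrite addr0; congr (y _); apply: val_inj.
have h_inj : injective h.
  by move=> y z yz; apply/ffunP => d; rewrite -!hE yz.
have -> : [set x : {ffun 'I_n -> 'Z_q} | potential f g x]%SET = h @: [set: _]%SET.
  apply/setP => x; rewrite inE; apply/forallP/imsetP => [fx|[y _ ->] l].
    exists [ffun d => x (val d)] => //; apply/ffunP => l.
    by rewrite !ffunE (eqP (fx l)).
  by rewrite -[f l]/(val (r l)) hE ffunE.
rewrite card_imset// cardsT card_ffun card_ord Zp_cast//; congr (_ ^ _)%N.
by rewrite card_sig; apply: eq_card => l; rewrite !inE.
Qed.
End Counting.

Section Flats.
Variables (R : realType) (n : nat).
Local Notation V := 'rV[R]_n.
Implicit Types (f : 'I_n -> 'I_n) (g : 'I_n -> int).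

Definition potential_flat f g : set V := [set x | potential f g (x ord0)].

Lemma potential_flat_base f g : rooted f g ->
  potential_flat f g (\row_l (g l)%:~R).
Proof.
by move=> fg; apply/forallP => l; rewrite !mxE (fg l).2 add0r.
Qed.

(** The flat is the translate, by the point with coordinates [g], of the image of [h], the injective
    linear map that copies the value at each root to its whole class. *)
Lemma affine_dim_potential f g : rooted f g ->
  affine_dim (potential_flat f g) = #|root_nodes f|.
Proof.
move=> fg; pose D := {l : 'I_n | f l == l}.
pose r l : D := exist _ (f l) (introT eqP (fg l).1).
pose h (y : 'rV[R]_#|{: D}|) : V :=
  \row_l y ord0 (enum_rank (r l)).
have h_lin : linear h by move=> a y z; apply/rowP => l; rewrite !mxE.
pose hL := GRing.isLinear.Build R _ _ _ h h_lin.
pose hl : {linear 'rV[R]_#|{: D}| -> V} := HB.pack h hL.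
have hE (y : 'rV[R]_#|{: D}|) (d : D) : h y ord0 (val d) = y ord0 (enum_rank d).
  by rewrite mxE; congr (y _ (enum_rank _)); apply/val_inj/eqP/(valP d).
have [L LE] : exists L : 'Hom('rV[R]_#|{: D}|, V), L =1 h.
  by exists (linfun hl) => y; rewrite lfunE.
have ker0 : (lker L == 0)%VS.
  apply/lker0P => y z; rewrite !LE => yz.
  by apply/rowP => k; rewrite -(enum_valK k) -!hE yz.
have -> : potential_flat f g = translate (\row_l (g l)%:~R) (limg L).
  apply/seteqP; split=> [x /forallP fx|x] /=.
    apply/memv_imgP; exists (\row_k x ord0 (val (enum_val k))); first exact: memvf.
    apply/rowP => l; rewrite LE !mxE enum_rankK /=.
    by rewrite [in LHS](eqP (fx l)) addrK.
  move=> /memv_imgP[y _ xy]; apply/forallP => l.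
  have xE t : x ord0 t = h y ord0 t + (g t)%:~R.
    by have := congr1 (fun v : V => v ord0 t) xy; rewrite LE !mxE => <-; rewrite subrK.
  rewrite !xE (fg l).2 addr0; apply/eqP; congr (_ + _).
  by rewrite -[f l]/(val (r l)) hE mxE.
rewrite affine_dim_translate limg_dim_eq; last by rewrite (eqP ker0) capv0.
rewrite dimvf /dim /= mul1n card_sig; apply: eq_card => l; by rewrite !inE.
Qed.
End Flats.

(** * Counting modulo q *)

Lemma Zp_intr_neq0 (q : nat) (z : int) : (`|z| < q)%N -> z != 0 ->
  z%:~R != 0 :> 'Z_q.
Proof.
move=> zq z0; have q1 : (1 < q)%N by move: zq z0; lia.
have z1 : `|z|%N%:R != 0 :> 'Z_q.
  by rewrite -val_eqE /= val_Zp_nat// modn_small// absz_eq0.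
case: z z0 zq z1 => m _ _ //=.
by rewrite NegzE rmorphN oppr_eq0.
Qed.

Section Avoiders.
Variables (R : realType) (n : nat).
Local Notation V := 'rV[R]_n.
Implicit Types (s : 'I_n * 'I_n * int) (S : seq ('I_n * 'I_n * int)).

Definition hyp s : set V := diff_hyperplane s.1.1 s.1.2 s.2.

Definition monomial_dim (X : set V) : {poly int} :=
  if X == set0 then 0 else 'X^(affine_dim X).

Lemma monomial_dim0 : monomial_dim set0 = 0.
Proof. by rewrite /monomial_dim eqxx. Qed.

Lemma monomial_dim_potential f g : rooted f g ->
  monomial_dim (potential_flat f g : set V) = 'X^#|root_nodes f|.
Proof.
move=> fg; rewrite /monomial_dim affine_dim_potential//; case: eqP => // e.
by have := potential_flat_base R fg; rewrite e.
Qed.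

Lemma potential_flat_merge f g i j k : rooted f g -> f i != f j ->
  (potential_flat f g `&` hyp (i, j, k) : set V) =
  potential_flat (merge_root f i j) (merge_shift f g i j k).
Proof.
move=> fg ij; apply/seteqP; split=> x /=; rewrite /potential_flat /= potential_merge//.
  by move=> [-> e]; apply/eqP.
by move=> /andP[-> /eqP].
Qed.

Lemma hyp_unmerged f g i j k (x : V) : potential_flat f g x -> f i = f j ->
  hyp (i, j, k) x <-> g i - g j = k.
Proof.
move=> fx ij; have := potential_unmerged k fx ij => e; split=> [h|gk].
  apply/eqP; rewrite -subr_eq0 -(intr_eq0 R) -e subr_eq0; apply/eqP; exact: h.
have : g i - g j - k = 0 by rewrite gk subrr.
rewrite /hyp/diff_hyperplane /= => z; apply/eqP; rewrite -subr_eq0 e.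
by rewrite z.
Qed.

Definition avoids (Z : nzRingType) S (x : 'I_n -> Z) : bool :=
  all (fun s => x s.1.1 - x s.1.2 != s.2%:~R) S.

(** Both sides obey the same recursion, whether the first hyperplane crosses the flat, contains it
    or is parallel to it. The bound [q0] collects the conditions on q from the parallel cases. *)
Lemma delres_count S f g : rooted f g -> exists q0 : nat,
  forall q : nat, (q0 <= q)%N -> (1 < q)%N ->
  (delres monomial_dim (potential_flat f g : set V) (map hyp S)).[q%:Z] =
  (#|[set x : {ffun 'I_n -> 'Z_q} | potential f g x && avoids S x]%SET|)%:Z.
Proof.
elim: S f g => [|[[i j] k] S IH] f g fg /=.
  exists 0 => q _ q1; rewrite monomial_dim_potential// hornerXn.
  rewrite -natz -natrX -(card_potential q1 fg) natz; congr Posz.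
  by apply: eq_card => x; rewrite !inE andbT.
have [q0 q0P] := IH f g fg.
have [ij|ij] := eqVneq (f i) (f j); last first.
  have [q1 q1P] := IH _ _ (rooted_merge k fg ij).
  exists (maxn q0 q1) => q; rewrite geq_max => /andP[q0q q1q] qgt1.
  rewrite potential_flat_merge// hornerD hornerN q0P// q1P//.
  rewrite -(cardsID [set x : {ffun 'I_n -> 'Z_q} | x i - x j == k%:~R]%SET
    [set x : {ffun 'I_n -> 'Z_q} | potential f g x && avoids S x]%SET).
  rewrite PoszD addrAC (_ : #|_ :&: _|%SET = #|[set x : {ffun 'I_n -> 'Z_q} |
    potential (merge_root f i j) (merge_shift f g i j k) x && avoids S x]%SET|).
    rewrite subrr add0r; congr Posz; apply: eq_card => x; rewrite !inE.
    by rewrite andbCA.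
  by apply: eq_card => x; rewrite !inE potential_merge// andbAC.
have [gk|gk] := eqVneq (g i - g j) k.
  exists 0 => q _ _; have -> : (potential_flat f g `&` hyp (i, j, k) : set V) = potential_flat f g.
    apply/setIidl => x fx; exact/(hyp_unmerged k fx ij).
  rewrite subrr horner0; apply/esym/eqP; rewrite eqz_nat cards_eq0.
  apply/eqP/setP => x; rewrite !inE; apply/negP => /and3P[fx /negP[]].
  by rewrite -subr_eq0 (potential_unmerged _ fx ij) gk subrr.
(* The hyperplane misses the real flat; it also does so modulo q once q exceeds the nonzero integer
   [g i - g j - k] in absolute value. *)
exists (maxn q0 `|(g i - g j - k)%R|%N.+1) => q; rewrite geq_max => /andP[q0q gq] q1.
have -> : (potential_flat f g `&` hyp (i, j, k) : set V) = set0.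
  rewrite -subset0 => x [fx]; rewrite (hyp_unmerged k fx ij); exact/eqP.
rewrite delres_set0 ?monomial_dim0// subr0 q0P//; congr Posz.
apply: eq_card => x; rewrite !inE; case fx : potential => //=.
rewrite -[x i - x j == _]subr_eq0 (potential_unmerged _ fx ij) Zp_intr_neq0//.
by rewrite subr_eq0.
Qed.
End Avoiders.

(** * Cells and regions *)

Section Cells.
Variables (R : realType) (n : nat).
Local Notation V := 'rV[R]_n.
Implicit Types (s : 'I_n * 'I_n * int) (S : seq ('I_n * 'I_n * int)).
Implicit Types (K C : set V) (x y v : V) (t : R).

Definition slope s x : R := x ord0 s.1.1 - x ord0 s.1.2.

Definition height s x : R := slope s x - s.2%:~R.

Lemma heightD s x v t : height s (x + t *: v) = height s x + t * slope s v.
Proof. by rewrite /height /slope !mxE; ring. Qed.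

Lemma height_segment s x y t :
  height s (x + t *: (y - x)) = (1 - t) * height s x + t * height s y.
Proof. by rewrite heightD /height /slope !mxE; ring. Qed.

Lemma hypE s x : hyp s x <-> height s x = 0.
Proof.
rewrite /hyp /diff_hyperplane /height /slope /=.
by split=> [->|/eqP]; rewrite ?subrr// subr_eq0 => /eqP.
Qed.

Definition above s : set V := [set x | 0 < height s x].
Definition below s : set V := [set x | height s x < 0].

Definition segment_closed K := forall x y t,
  K x -> K y -> 0 <= t <= 1 -> K (x + t *: (y - x)).

(* Near its points on the hyperplane [s], [K] extends to both sides of it. *)
Definition transversal K s := forall x, K x -> height s x = 0 ->
  exists2 v, slope s v = 1 &
    exists2 e : R, 0 < e & forall t, `|t| < e -> K (x + t *: v).

Lemma segment_closedI_above K s :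
  segment_closed K -> segment_closed (K `&` above s).
Proof.
move=> Kc x y t [Kx sx] [Ky sy] t01; split; first exact: Kc.
by rewrite /above /= height_segment; move: sx sy; rewrite /above/=; nra.
Qed.

Lemma segment_closedI_below K s :
  segment_closed K -> segment_closed (K `&` below s).
Proof.
move=> Kc x y t [Kx sx] [Ky sy] t01; split; first exact: Kc.
by rewrite /below /= height_segment; move: sx sy; rewrite /below/=; nra.
Qed.

(** A small step along [v] cannot change the sign of a nonzero height, so [transversal] survives
    intersection with open half-spaces. *)
Let height_near u x v : height u x != 0 ->
  exists2 e : R, 0 < e & forall t, `|t| < e ->
    `|t * slope u v| < `|height u x|.
Proof.
move=> h0; have hp : 0 < `|height u x| by rewrite normr_gt0.
(* The added 1 keeps the denominator positive when the slope vanishes. *)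
have dp : 0 < `|slope u v| + 1 by rewrite ltr_wpDl.
exists (`|height u x| / (`|slope u v| + 1)); first by rewrite divr_gt0.
move=> t; rewrite ltr_pdivlMr// => te; rewrite normrM; apply: le_lt_trans te.
by rewrite ler_wpM2l// lerDl.
Qed.

Lemma transversalI_above K s u : transversal K s -> transversal (K `&` above u) s.
Proof.
move=> Kt x [Kx ux] sx; have [v sv [e e0 eK]] := Kt x Kx sx; exists v => //.
have [|d d0 dP] := @height_near u x v; first by rewrite gt_eqF.
exists (Num.min e d); first by rewrite lt_min e0.
move=> t; rewrite lt_min => /andP[te td]; split; first exact: eK.
move: (dP _ td) ux; rewrite /above /= heightD ltr_norml; move=> + h0.
by rewrite gtr0_norm// => /andP[]; lra.
Qed.

Lemma transversalI_below K s u : transversal K s -> transversal (K `&` below u) s.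
Proof.
move=> Kt x [Kx ux] sx; have [v sv [e e0 eK]] := Kt x Kx sx; exists v => //.
have [|d d0 dP] := @height_near u x v; first by rewrite lt_eqF.
exists (Num.min e d); first by rewrite lt_min e0.
move=> t; rewrite lt_min => /andP[te td]; split; first exact: eK.
move: (dP _ td) ux; rewrite /below /= heightD ltr_norml; move=> + h0.
by rewrite ltr0_norm// => /andP[]; lra.
Qed.

(** Empty pieces are discarded only at the end, so the size is the number of sign patterns on [S]
    realised by points of [K] off the hyperplanes. *)
Fixpoint cells K S : seq (set V) :=
  if S is s :: S' then cells (K `&` above s) S' ++ cells (K `&` below s) S'
  else if `[< K !=set0 >] then [:: K] else [::].

Lemma cells0 S : cells set0 S = [::].
Proof.
elim: S => [|s S IH] /=; last by rewrite !set0I IH.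
by case: asboolP => // -[].
Qed.

Lemma size_cells_nil K : size (cells K [::]) = `[< K !=set0 >] :> nat.
Proof. by rewrite /=; case: asboolP. Qed.

(* By induction on [S] this reduces to [S] empty: [K] meets both sides of [s]
   iff it meets [s], by [segment_closed] and [transversal]. *)
Lemma size_cellsD K s S : segment_closed K -> transversal K s ->
  (size (cells (K `&` above s) S) + size (cells (K `&` below s) S) =
   size (cells K S) + size (cells (K `&` hyp s) S))%N.
Proof.
elim: S K => [|u S IH] K Kc Kt.
  rewrite !size_cells_nil.
  have [[x [Kx /hypE sx]]|K0] := pselect (K `&` hyp s !=set0).
    have [v sv [e e0 eK]] := Kt x Kx sx.
    rewrite asboolT; last first.
      exists (x + (e / 2) *: v); split; last first.
        by rewrite /above /= heightD sx sv; lra.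
      by apply: eK; rewrite gtr0_norm; lra.
    rewrite asboolT; last first.
      exists (x + (- (e / 2)) *: v); split; last first.
        by rewrite /below /= heightD sx sv; lra.
      by apply: eK; rewrite normrN gtr0_norm; lra.
    rewrite asboolT; last by exists x.
    by rewrite asboolT//; exists x; split=> //; apply/hypE.
  rewrite [in RHS](asboolF K0) addn0.
  have KK x : K x -> height s x != 0.
    by move=> Kx; apply/eqP => /hypE sx; apply: K0; exists x.
  have [[x [Kx sx]]|Ka] := pselect (K `&` above s !=set0).
    rewrite asboolT; last by exists x.
    rewrite [in RHS]asboolT; last by exists x.
    rewrite asboolF// => -[y [Ky sy]].
    move: sx sy; rewrite /above /below /= => sx sy.
    (* At this parameter the segment from [x] to [y] crosses the hyperplane. *)
    have := KK _ (Kc x y (height s x / (height s x - height s y)) Kx Ky _).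
    have dp : 0 < height s x - height s y by lra.
    rewrite height_segment => /(_ _)/negP; apply.
      rewrite divr_ge0 /=; [|lra|lra]; rewrite ler_pdivrMr//; lra.
    by apply/eqP; field; lra.
  rewrite (asboolF Ka) add0n; congr nat_of_bool; apply: asbool_equiv_eq.
  split=> -[x]; first by case=> Kx _; exists x.
  move=> Kx; exists x; split=> //; rewrite /below /= lt_neqAle KK //=.
  by rewrite leNgt; apply/negP => sx; apply: Ka; exists x.
have IHa := IH _ (segment_closedI_above (s := u) Kc) (transversalI_above (u := u) Kt).
have IHb := IH _ (segment_closedI_below (s := u) Kc) (transversalI_below (u := u) Kt).
rewrite /= !size_cat (setIAC K (above s) (above u)) (setIAC K (above s) (below u)).
rewrite (setIAC K (below s) (above u)) (setIAC K (below s) (below u)).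
by rewrite addnACA IHa IHb addnACA (setIAC K (hyp s) (above u)) (setIAC K (hyp s) (below u)).
Qed.

Lemma segment_closed_flat f g : segment_closed (potential_flat f g).
Proof.
move=> x y t /forallP fx /forallP fy _; apply/forallP => l.
by rewrite !mxE (eqP (fx l)) (eqP (fy l)); apply/eqP; ring.
Qed.

Lemma transversal_flat f g i j k : rooted f g -> f i != f j ->
  transversal (potential_flat f g) (i, j, k).
Proof.
(* Moving exactly the class of [i] stays in the flat; [j] lies in another class, so the slope is
   1. *)
move=> fg ij x /forallP fx _; exists (\row_l (f l == f i)%:R).
  by rewrite /slope !mxE eqxx eq_sym (negbTE ij) subr0.
exists 1 => // t _; apply/forallP => l.
by rewrite !mxE (fg l).1 (eqP (fx l)); apply/eqP; ring.
Qed.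

(** Zaslavsky's theorem on a flat: [size_cellsD] adds where [delres] subtracts, and restricting to a
    crossing hyperplane removes one root, so the sign reconciles the two. *)
Lemma size_cells_delres S f g : rooted f g ->
  (size (cells (potential_flat f g) S))%:Z = (-1) ^+ #|root_nodes f| *
    (delres (@monomial_dim R n) (potential_flat f g) (map (@hyp R n) S)).[-1].
Proof.
elim: S f g => [|[[i j] k] S IH] f g fg.
  rewrite size_cells_nil asboolT; last by exact: (ex_intro _ _ (potential_flat_base R fg)).
  by rewrite /= monomial_dim_potential// hornerXn -exprMn mulrNN mulr1 expr1n.
rewrite [cells _ _]/= size_cat [delres _ _ _]/= hornerD hornerN mulrDr -IH//.
have [ij|ij] := eqVneq (f i) (f j); last first.
  rewrite (size_cellsD _ (@segment_closed_flat f g) (@transversal_flat f g i j k fg ij)).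
  rewrite PoszD; congr (_ + _); rewrite potential_flat_merge// IH; last exact: rooted_merge.
  by rewrite (card_roots_merge fg ij) exprS mulN1r mulrNN.
(* If the hyperplane contains the flat, neither open side has cells and the terms of [delres]
   cancel; otherwise it misses the flat and cuts nothing. *)
have [gk|gk] := eqVneq (g i - g j) k.
  have FH : (potential_flat f g `&` hyp (i, j, k) : set V) = potential_flat f g.
    by apply/setIidl => x fx; exact/(hyp_unmerged k fx ij).
  rewrite FH mulrN -IH// subrr.
  have -> : (potential_flat f g `&` above (i, j, k) : set V) = set0.
    by rewrite -subset0 -FH => x [[_ /hypE h0]]; rewrite /above /= h0 ltxx.
  have -> : (potential_flat f g `&` below (i, j, k) : set V) = set0.
    by rewrite -subset0 -FH => x [[_ /hypE h0]]; rewrite /below /= h0 ltxx.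
  by rewrite cells0.
have FH : (potential_flat f g `&` hyp (i, j, k) : set V) = set0.
  rewrite -subset0 => x [fx]; rewrite (hyp_unmerged k fx ij); exact/eqP.
rewrite size_cellsD ?FH ?cells0 ?addn0; last 2 first.
- exact: segment_closed_flat.
- by move=> x Fx /hypE hx; have : (potential_flat f g `&` hyp (i, j, k)) x by []; rewrite FH.
by rewrite delres_set0 ?monomial_dim0// horner0 oppr0 mulr0 addr0.
Qed.

End Cells.

(** * Regions as cells *)

Section Regions.
Variables (R : realType) (n : nat).
Local Notation V := 'rV[R]_n.
Implicit Types (s : 'I_n * 'I_n * int) (S : seq ('I_n * 'I_n * int)).
Implicit Types (K C : set V) (x y v : V) (t : R).

Definition generic S x : bool := all (fun s => height s x != 0) S.

Definition chamber S x : set V :=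
  [set y | all (fun s => 0 < height s x * height s y) S].

Lemma mem_cells S K C : C \in cells K S <->
  exists2 x, K x /\ generic S x & C = K `&` chamber S x.
Proof.
elim: S K => [|s S IH] K.
  rewrite /=; case: asboolP => K0; last first.
    by split=> // -[x [Kx _]]; case: K0; exists x.
  rewrite inE; split=> [/eqP->|[x _ ->]]; last by apply/eqP/setIidl.
  by have [x Kx] := K0; exists x => //; apply/esym/setIidl.
rewrite /= mem_cat; split=> [/orP[]/IH[x [[Kx sx] gx] ->]|].
- exists x; first by split=> //; apply/andP; split=> //; rewrite gt_eqF.
  apply/seteqP; split=> y; rewrite /chamber /above /=.
    by move=> [[Ky sy] xy]; rewrite xy mulr_gt0.
  by move=> [Ky /andP[+ xy]]; rewrite pmulr_rgt0 => // ?; do !split.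
- exists x; first by split=> //; apply/andP; split=> //; rewrite lt_eqF.
  apply/seteqP; split=> y; rewrite /chamber /below /=.
    by move=> [[Ky sy] xy]; rewrite xy nmulr_rgt0 ?andbT.
  by move=> [Ky /andP[+ xy]]; rewrite nmulr_rgt0 => // ?; do !split.
move=> [x [Kx /andP[/= sx gx]] CE].
case: (ltgtP 0 (height s x)) => [sp|sn|s0]; last by rewrite -s0 eqxx in sx.
  apply/orP; left; apply/IH; exists x => //; rewrite CE.
  apply/seteqP; split=> y; rewrite /chamber /above /=.
    by move=> [Ky /andP[+ xy]]; rewrite pmulr_rgt0 => // ?; do !split.
  by move=> [[Ky sy] xy]; rewrite xy mulr_gt0.
apply/orP; right; apply/IH; exists x => //; rewrite CE.
apply/seteqP; split=> y; rewrite /chamber /below /=.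
  by move=> [Ky /andP[+ xy]]; rewrite nmulr_rgt0 => // ?; do !split.
by move=> [[Ky sy] xy]; rewrite xy nmulr_rgt0 ?andbT.
Qed.

Lemma mem_chamber S x : generic S x -> chamber S x x.
Proof.
by move=> gx; apply: sub_all gx => s /= sx; rewrite -expr2 exprn_even_gt0.
Qed.

Lemma uniq_cells S K : uniq (cells K S).
Proof.
elim: S K => [|s S IH] K /=; first by case: asboolP.
rewrite cat_uniq !IH andbT; apply/hasPn => C /mem_cells[x [[Kx sx] gx] CE].
apply/negP => /mem_cells[y _ CE'].
have : C x by rewrite CE; split=> //; exact: mem_chamber.
rewrite CE' => -[[_ sx'] _]; move: sx sx'; rewrite /above /below /=.
by move=> a b; have := lt_trans a b; rewrite ltxx.
Qed.

Lemma height_continuous s : continuous (@height R n s).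
Proof.
move=> x; have h i : {for x, continuous (fun y : V => y ord0 i)} by exact: coord_continuous.
have hs : {for x, continuous (@slope R n s)} by exact: continuousB.
by apply: continuousB => //; exact: cst_continuous.
Qed.

Lemma segment_image_connected x y :
  connected ((fun t => x + t *: (y - x)) @` `[0, 1]%classic).
Proof.
apply: connected_continuous_connected; first exact: segment_connected.
apply: continuous_subspaceT => t; apply: cvgD; first exact: cvg_cst.
by apply: cvgZr_tmp; exact: cvg_id.
Qed.

(** On a connected set off the hyperplanes each height takes an interval of values without 0, hence
    keeps its sign; conversely, the segment to a point of the chamber avoids the hyperplanes. *)
Lemma connected_component_chamber S x : generic S x ->
  connected_component (fun y => generic S y) x = chamber S x.
Proof.
move=> gx; apply/seteqP; split=> [y [B [Bx BS Bc] By]|y xy].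
  apply/allP => s sS.
  have /connected_intervalP Bi : connected (height s @` B).
    apply: connected_continuous_connected => //.
    by apply: continuous_subspaceT; exact: height_continuous.
  have B0 z : B z -> height s z != 0 by move=> /BS /allP; apply.
  have no0 : ~ (height s @` B) 0 by move=> [z /B0 + e]; rewrite e eqxx.
  have bx : (height s @` B) (height s x) by exists x.
  have bz : (height s @` B) (height s y) by exists y.
  case: (ltgtP 0 (height s x)) (B0 _ Bx) => // [xp|xn] _;
    case: (ltgtP 0 (height s y)) (B0 _ By) => // [yp|yn] _.
  - exact: mulr_gt0.
  - by case: no0; apply: (Bi _ _ bz bx); rewrite !ltW.
  - by case: no0; apply: (Bi _ _ bx bz); rewrite !ltW.
  - by rewrite nmulr_rgt0.
exists ((fun t => x + t *: (y - x)) @` `[0, 1]%classic); last first.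
  exists 1; last by rewrite scale1r addrC subrK.
  by rewrite /= in_itv /= lexx ler01.
split; last exact: segment_image_connected.
  exists 0; last by rewrite scale0r addr0.
  by rewrite /= in_itv /= lexx ler01.
move=> z [t]; rewrite /= in_itv /= => /andP[t0 t1] <-; apply/allP => s sS.
have /allP/(_ s sS) /= := xy; have /allP/(_ s sS) /= := gx.
rewrite height_segment; set a := height s x; set b := height s y => a0 ab.
apply/negP => /eqP z0.
have a2 : 0 < a ^+ 2 by rewrite exprn_even_gt0.
(* Multiplied by [a], the vanishing height becomes a sum of two nonnegative terms that cannot both
   vanish. *)
have : (1 - t) * a ^+ 2 + t * (a * b) = 0.
  by rewrite -[RHS](mulr0 a) -z0; ring.
have [->|tn0] := eqVneq t 0; first by lra.
have : 0 < t * (a * b) by rewrite mulr_gt0// lt_def tn0.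
have : 0 <= (1 - t) * a ^+ 2 by rewrite mulr_ge0 ?subr_ge0// ltW.
lra.
Qed.

Lemma regions_cells (A : {fset set V}) S :
  A =i map (@hyp R n) S -> regions A = [set` cells setT S].
Proof.
move=> AS; rewrite /regions.
have -> : ~` (\bigcup_(H in [set` A]) H) = (fun y => generic S y).
  apply/seteqP; split=> y.
    move=> yA; apply/allP => s sS; apply/negP => /eqP /hypE sy; apply: yA.
    by exists (hyp s) => //=; rewrite AS map_f.
  move=> gy [H /=]; rewrite AS => /mapP[s sS ->] /hypE sy.
  by have /allP/(_ _ sS) := gy; rewrite sy eqxx.
apply/seteqP; split=> C.
  move=> [x gx <-]; apply/mem_cells; exists x => //.
  by rewrite setTI connected_component_chamber.
move=> /mem_cells[x [_ gx] ->]; exists x => //.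
by rewrite setTI connected_component_chamber.
Qed.

Lemma card_regions (A : {fset set V}) S :
  A =i map (@hyp R n) S -> (regions A #= `I_(size (cells (@setT V) S)))%card.
Proof.
move=> AS; rewrite (regions_cells AS).
have -> : [set` cells setT S] = [set` [fset C in cells (@setT V) S]%fset].
  by apply/seteqP; split=> C /=; rewrite !inE.
by apply/card_eq_fsetP; rewrite card_fseq undup_id ?uniq_cells.
Qed.
End Regions.

(** * Blocks on a line *)

Section Blocks.
Variables (n : nat) (c : 'I_n -> nat).
Hypothesis c_gt0 : forall i, (0 < c i)%N.
Implicit Types (i j l : 'I_n) (phi p : 'I_n -> nat).

Definition lex_lt phi j i : bool :=
  ((phi j < phi i) || (phi j == phi i) && (j < i))%N.

(* [phi i] is the number of uncovered cells to the left of block [i], which has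
   length [c i]; blocks with the same [phi i] are sorted by index. *)
Definition place phi i : nat := (phi i + \sum_(j | lex_lt phi j i) c j)%N.

(** Inverse to [place] on packed positions, where the truncated subtraction is exact by
    [packed_gaps]. *)
Definition gaps p i : nat := (p i - \sum_(j | (p j < p i)%N) c j)%N.

(* Block [i] covers the cells from [p i] to [p i + c i - 1]. *)
Definition packed p : Prop := forall i j, (i < j)%N ->
  (p i + c i <= p j)%N \/ (p j + c j < p i)%N.

Let lex_total phi i j : i != j -> lex_lt phi i j \/ lex_lt phi j i.
Proof. by rewrite -val_eqE /= /lex_lt; lia. Qed.

Let lex_trans phi : transitive (lex_lt phi).
Proof. by move=> j i l; rewrite /lex_lt; lia. Qed.

Let lex_asym phi i j : lex_lt phi i j -> ~~ lex_lt phi j i.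
Proof. by rewrite /lex_lt; lia. Qed.

Let sum_pred_lt (P Q : pred 'I_n) j : (forall l, P l -> Q l) ->
  ~~ P j -> Q j -> (\sum_(l | P l) c l + c j <= \sum_(l | Q l) c l)%N.
Proof.
move=> PQ nPj Qj; rewrite addnC [leqRHS](bigD1 j)//= leq_add2l.
rewrite [leqRHS](bigID P)/= -[leqLHS]addn0 leq_add//.
rewrite leq_eqVlt; apply/orP; left; apply/eqP/eq_bigl => l.
have [lj|] := eqVneq l j; first by rewrite lj (negbTE nPj) !andbF.
by move=> _; have := PQ l; case: (P l) => [/(_ isT)->|]; rewrite ?andbF.
Qed.

Lemma place_lt phi j i : lex_lt phi j i ->
  (place phi j + c j + (phi i - phi j) <= place phi i)%N.
Proof.
move=> ji; have : (\sum_(l | lex_lt phi l j) c l + c j <= \sum_(l | lex_lt phi l i) c l)%N.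
  apply: sum_pred_lt => //; last by rewrite /lex_lt !ltnn andbF.
  by move=> l lj; apply: lex_trans ji.
by rewrite /place; move: ji; rewrite /lex_lt; lia.
Qed.

Lemma packed_place phi : packed (place phi).
Proof.
move=> i j ij; have [|h|h] := @lex_total phi i j; first by rewrite -val_eqE /=; lia.
  by left; have := place_lt h; lia.
by right; have := place_lt h; move: h; rewrite /lex_lt; lia.
Qed.

Lemma ltn_place phi j i : (place phi j < place phi i)%N = lex_lt phi j i.
Proof.
apply/idP/idP => [ji|/place_lt]; last by have := c_gt0 j; lia.
have [e|/(@lex_total phi)[//|/place_lt]] := eqVneq j i; last by lia.
by rewrite e ltnn in ji.
Qed.

Lemma gaps_place phi i : gaps (place phi) i = phi i.
Proof.
rewrite /gaps (eq_bigl (fun j => lex_lt phi j i)); last by move=> j; rewrite ltn_place.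
by rewrite /place addnK.
Qed.

Lemma place_bound phi i : (place phi i + c i <= phi i + \sum_j c j)%N.
Proof.
rewrite /place -addnA leq_add2l; apply: sum_pred_lt => //.
by rewrite /lex_lt ltnn eqxx ltnn.
Qed.

Lemma place_min phi i : val i = 0%N -> phi i = 0%N -> place phi i = 0%N.
Proof.
move=> i0 p0; rewrite /place p0 big_pred0// => j.
by rewrite /lex_lt p0 [nat_of_ord i]i0 !ltn0 andbF.
Qed.

Lemma gaps_min p i : p i = 0%N -> gaps p i = 0%N.
Proof. by rewrite /gaps => ->. Qed.

Section Packed.
Variables (p : 'I_n -> nat) (p_packed : packed p).

Let separated_lt i j : (p i < p j)%N ->
  (p i + c i <= p j)%N /\ ((p i + c i == p j) ==> (i < j))%N.
Proof.
move=> pij; have := c_gt0 i; have := c_gt0 j.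
case: (ltngtP (val i) (val j)) => [ij|ji|/val_inj ij].
- by have := p_packed ij; lia.
- by have := p_packed ji; lia.
by rewrite ij ltnn in pij.
Qed.

Let p_inj : injective p.
Proof.
move=> i j pij; apply/eqP; case: (ltngtP (val i) (val j)) => [ij|ji|/val_inj/eqP//].
  by have := p_packed ij; have := c_gt0 i; have := c_gt0 j; lia.
by have := p_packed ji; have := c_gt0 i; have := c_gt0 j; lia.
Qed.

(** Strong induction on the position. With [l] the last block to the left of [i], the gaps grow from
    [l] to [i] by [p i - p l - c l], which is nonnegative, and zero only if [l < i]. *)
Lemma packed_gaps i : (\sum_(j | (p j < p i)%N) c j <= p i)%N /\
  forall j, (p j < p i)%N -> lex_lt (gaps p) j i.
Proof.
have [k] := ubnP (p i); elim: k i => // k IH i pk.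
case: (pickP (fun j => p j < p i)%N) => [j0 j0i|none]; last first.
  by rewrite big_pred0//; split=> // j; rewrite none.
case: (@arg_maxnP _ j0 (fun j => p j < p i)%N p j0i) => l li lmax.
have pred_i j : (p j < p i)%N = (j == l) || (p j < p l)%N.
  apply/idP/orP => [ji|[/eqP->//|jl]]; last exact: ltn_trans li.
  by have /= := lmax _ ji; rewrite leq_eqVlt => /orP[/eqP/p_inj->|]; [left|right].
have [|sl lexl] := IH l; first by apply: leq_trans li _; rewrite -ltnS.
have si : (\sum_(j | (p j < p i)%N) c j = c l + \sum_(j | (p j < p l)%N) c j)%N.
  rewrite (bigD1 l)//=; congr (_ + _)%N; apply: eq_bigl => j; rewrite pred_i.
  by have [->|] := eqVneq j l; rewrite ?andbT// ltnn.
have [sep sepeq] := separated_lt li.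
have lexli : lex_lt (gaps p) l i.
  by rewrite /lex_lt /gaps si; move: sl sep sepeq; lia.
split; first by rewrite si; move: sl sep; lia.
move=> j; rewrite pred_i => /orP[/eqP->//|jl].
exact: lex_trans (lexl j jl) lexli.
Qed.

Lemma lex_gaps j i : lex_lt (gaps p) j i = (p j < p i)%N.
Proof.
apply/idP/idP => [ji|]; last by move=> /((packed_gaps i).2).
case: (ltngtP (p j) (p i)) => // [/((packed_gaps j).2)|/p_inj e].
  by move=> /lex_asym; rewrite ji.
by move: ji; rewrite e /lex_lt ltnn eqxx ltnn.
Qed.

Lemma place_gaps i : place (gaps p) i = p i.
Proof.
rewrite /place (eq_bigl _ _ (fun j => lex_gaps j i)) /gaps subnK//.
exact: (packed_gaps i).1.
Qed.

(** Gaps never decrease along the line, so it suffices to treat the last block [m], which has all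
    the others to its left. *)
Lemma gaps_bound q i : (forall j, p j + c j < q)%N ->
  (gaps p i + \sum_j c j < q)%N.
Proof.
move=> pq; case: (@arg_maxnP _ i predT p isT) => m _ mmax'.
have mmax j : (p j <= p m)%N by exact: mmax'.
have sm : (\sum_j c j = c m + \sum_(j | (p j < p m)%N) c j)%N.
  rewrite (bigD1 m)//=; congr (_ + _)%N; apply: eq_bigl => j.
  rewrite ltn_neqAle mmax// andbT; congr (~~ _).
  by apply/eqP/eqP => [->|/p_inj].
have : (gaps p i <= gaps p m)%N.
  have [->//|im] := eqVneq i m.
  have : (p i < p m)%N.
    by rewrite ltn_neqAle mmax// andbT; apply: contra im => /eqP/p_inj->.
  by rewrite -lex_gaps /lex_lt; lia.
have := (packed_gaps m).1; have := pq m; rewrite sm {2}/gaps; lia.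
Qed.
End Packed.
End Blocks.

(** * The Shi arrangement *)

Section ShiConstraints.
Variables (n : nat) (c : 'I_n -> nat).

Lemma double_shi_m i : (shi_m c i + shi_m c i = c i + odd (c i))%N.
Proof.
rewrite /shi_m addnn; have := odd_double_half (c i); have := odd_double_half (c i).+1.
by rewrite /=; case: odd => /=; lia.
Qed.

(** With [shi_hiE]: shifting each coordinate by [shi_m] turns the range of k into [1 - c_i, c_j],
    free of parities. Over the integers, avoiding this range is the condition of [packed]. *)
Lemma shi_loE i j : shi_lo c i j = 1 - (c i)%:Z + ((shi_m c i)%:Z - (shi_m c j)%:Z).
Proof. by have := double_shi_m i; rewrite /shi_lo; lia. Qed.

Lemma shi_hiE i j : shi_hi c i j = (c j)%:Z + ((shi_m c i)%:Z - (shi_m c j)%:Z).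
Proof. by have := double_shi_m j; rewrite /shi_hi; lia. Qed.

(** The range of k has c_j - (1 - c_i) + 1 = c_i + c_j elements. *)
Definition shi_constraints : seq ('I_n * 'I_n * int) :=
  [seq (u, shi_lo c u.1 u.2 + r%:Z) |
    u <- [seq u : 'I_n * 'I_n <- enum {: 'I_n * 'I_n} | (u.1 < u.2)%N],
    r <- iota 0 (c u.1 + c u.2)].

Lemma mem_shi_constraints i j k : ((i, j, k) \in shi_constraints) =
  (i < j)%N && (shi_lo c i j <= k <= shi_hi c i j).
Proof.
apply/allpairsPdep/idP => [[[i' j'] [r []]]|/andP[ij /andP[lok khi]]].
  rewrite mem_filter mem_iota => /andP[/= ij _] rc [-> -> ->]; rewrite ij /=.
  by move: rc; rewrite shi_loE shi_hiE; lia.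
exists (i, j), `|(k - shi_lo c i j)%R|%N; split.
- by rewrite mem_filter mem_enum ij.
- by rewrite mem_iota; move: lok khi; rewrite shi_loE shi_hiE /=; lia.
by congr (_, _); rewrite /= gez0_abs ?subr_ge0// addrC subrK.
Qed.

Lemma shi_arrangementE (R : realType) :
  shi_arrangement R c =i map (@hyp R n) shi_constraints.
Proof.
move=> H; apply/idP/mapP => [/mem_shi_arrangement[i [j [k [ij k_in ->]]]]|].
  by exists (i, j, k); rewrite // mem_shi_constraints ij.
move=> [[[i j] k]]; rewrite mem_shi_constraints => /andP[ij k_in] ->.
by apply/mem_shi_arrangement; exists i, j, k.
Qed.

Lemma setT_shi_arrangement (R : realType) : setT \notin shi_arrangement R c.
Proof.
apply/negP => /mem_shi_arrangement[i [j [k [ij _ TH]]]].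
pose x t : 'rV[R]_n := \row_l if l == i then t else 0.
have xk (t : R) : t = k%:~R.
  have : (diff_hyperplane i j k : set 'rV[R]_n) (x t) by rewrite -TH.
  have ji : j != i by rewrite -val_eqE gtn_eqF.
  by rewrite /diff_hyperplane /= !mxE eqxx (negbTE ji) subr0.
by have := xk 0; rewrite -(xk 1) => /esym/eqP; rewrite oner_eq0.
Qed.
End ShiConstraints.

(** * Points modulo q off the Shi hyperplanes *)

Section ModularCount.
Variables (n : nat) (c : 'I_n -> nat).
Hypotheses (c_gt0 : forall i, (0 < c i)%N).
Variables (i0 : 'I_n) (i0E : val i0 = 0%N) (G : nat).
Let C := (\sum_i c i)%N.
(** Blocks of total length [C] leave [G.+1] cells of the circle uncovered. *)
Let q := (C + G.+1)%N.

Let le_cC i : (c i <= C)%N. Proof. by rewrite /C (bigD1 i)//= leq_addr. Qed.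

Let q_gt1 : (1 < q)%N.
Proof. by have := le_cC i0; have := c_gt0 i0; rewrite /q; lia. Qed.

Let blocks_of (t : 'Z_q) (p : 'I_n -> nat) : 'I_n -> 'Z_q :=
  fun i => t + (shi_m c i + p i)%:R.

Let blocks_diff t p i j (k : int) :
  (blocks_of t p i - blocks_of t p j == k%:~R) =
  (((p i)%:Z - (p j)%:Z - (k - ((shi_m c i)%:Z - (shi_m c j)%:Z)))%:~R == 0 :> 'Z_q).
Proof.
rewrite -subr_eq0 /blocks_of; congr (_ == 0).
rewrite -[(shi_m c i + p i)%:R]/((shi_m c i + p i)%N%:Z%:~R).
rewrite -[(shi_m c j + p j)%:R]/((shi_m c j + p j)%N%:Z%:~R).
by rewrite !PoszD; ring.
Qed.

(** The integer that must not vanish modulo q is nonzero because the blocks are packed, and below q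
    in absolute value because every block ends before the last cell. *)
Lemma avoids_packed t p : packed c p -> (forall i, p i + c i < q)%N ->
  avoids (shi_constraints c) (blocks_of t p).
Proof.
move=> pp pq; apply/allP => -[[i j] k]; rewrite mem_shi_constraints => /andP[ij].
rewrite shi_loE shi_hiE /= blocks_diff => kin; apply: Zp_intr_neq0.
  by have := pp i j ij; have := pq i; have := pq j; move: kin; lia.
by have := pp i j ij; have := c_gt0 i; have := c_gt0 j; move: kin; lia.
Qed.

(** Block [i0] starts at 0 and has the least index, so a block with [p i + c i >= q] would overlap
    it around the circle or touch it from the wrong side; hence the strict bound. *)
Lemma packed_avoids t p : (forall i, p i < q)%N -> p i0 = 0%N ->
  avoids (shi_constraints c) (blocks_of t p) ->
  packed c p /\ forall i, (p i + c i < q)%N.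
Proof.
move=> pq p0 /allP px.
have neq (i j : 'I_n) (d : int) : (i < j)%N -> 1 - (c i)%:Z <= d <= (c j)%:Z ->
    ((p i)%:Z - (p j)%:Z - d)%:~R != 0 :> 'Z_q.
  move=> ij dij; pose k := d + ((shi_m c i)%:Z - (shi_m c j)%:Z).
  have := px (i, j, k); rewrite mem_shi_constraints ij shi_loE shi_hiE !lerD2r.
  by rewrite dij => /(_ isT); rewrite /= blocks_diff addrK.
split=> [i j ij|i].
  have := neq i j ((p i)%:Z - (p j)%:Z) ij; rewrite subrr eqxx.
  by case: (boolP (_ <= _ <= _)) => [_ /(_ isT)//|+ _]; lia.
have [->|ii0] := eqVneq i i0; first by rewrite p0 /q; have := le_cC i0; lia.
rewrite ltnNge; apply/negP => qi.
have i0i : (i0 < i)%N.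
  by rewrite [nat_of_ord i0]i0E lt0n; apply: contra ii0 => /eqP ii; apply/eqP/val_inj; rewrite i0E.
(* The offset [q - p i] lies in the forbidden range, while [p i0 - p i] minus it is -q, which
   vanishes modulo q. *)
have := neq i0 i (q%:Z - (p i)%:Z) i0i; rewrite p0.
have -> : 0%N%:Z - (p i)%:Z - (q%:Z - (p i)%:Z) = - q%:Z by ring.
have -> : (- q%:Z)%:~R = 0 :> 'Z_q.
  by rewrite rmorphN /= -[_%:~R]/(q%:R) pchar_Zp// oppr0.
by rewrite eqxx => nk; apply/notF/nk; move: (pq i) (c_gt0 i0) qi; lia.
Qed.

Lemma card_avoids :
  #|[set x : {ffun 'I_n -> 'Z_q} | avoids (shi_constraints c) x]%SET| =
  (q * G.+1 ^ n.-1)%N.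
Proof.
pose P := [set phi : {ffun 'I_n -> 'I_G.+1} | phi i0 == ord0]%SET.
pose X (u : 'Z_q * {ffun 'I_n -> 'I_G.+1}) : {ffun 'I_n -> 'Z_q} :=
  [ffun i => blocks_of u.1 (place c (fun i => u.2 i)) i].
have placeq (phi : {ffun 'I_n -> 'I_G.+1}) i : (place c (fun i => phi i) i + c i < q)%N.
  apply: leq_ltn_trans (place_bound c (fun i => phi i : nat) i) _.
  by rewrite /q addnC ltn_add2l.
have place0 (phi : {ffun 'I_n -> 'I_G.+1}) : phi \in P -> place c (fun i => phi i) i0 = 0%N.
  by rewrite inE => /eqP phi0; apply: place_min; rewrite ?phi0.
have -> : [set x : {ffun 'I_n -> 'Z_q} | avoids (shi_constraints c) x]%SET =
    X @: finset.setX [set: 'Z_q]%SET P.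
  apply/setP => x; rewrite inE; apply/idP/imsetP => [xa|[[t phi]]]; last first.
    rewrite !inE /= => /eqP phi0 ->.
    rewrite (_ : (X (t, phi) : _ -> _) = blocks_of t (place c (fun i => phi i))); last first.
      by apply/funext => i; rewrite ffunE.
    by apply: avoids_packed => //; exact: packed_place.
  (* The origin is chosen so that block [i0] starts at cell 0. *)
  pose t : 'Z_q := x i0 - (shi_m c i0)%:R.
  pose p i : nat := val (x i - t - (shi_m c i)%:R).
  have p0 : p i0 = 0%N by rewrite /p /t subKr subrr.
  have pq i : (p i < q)%N by rewrite -[X in (_ < X)%N](Zp_cast q_gt1) ltn_ord.
  have xE : (x : _ -> _) = blocks_of t p.
    apply/funext => i; rewrite /blocks_of natrD.
    rewrite [(p i)%:R](_ : _ = x i - t - (shi_m c i)%:R); last exact: natr_Zp.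
    by ring.
  move: xa; rewrite xE => /packed_avoids[]// pp pqc.
  have gq i : (gaps c p i < G.+1)%N.
    by have := gaps_bound c_gt0 pp i pqc; rewrite -/C /q; lia.
  exists (t, [ffun i => Ordinal (gq i)]).
    by rewrite !inE /= ffunE -val_eqE /= gaps_min.
  apply/ffunP => i; rewrite ffunE /= xE; congr (_ + (_ + _)%:R).
  rewrite -(place_gaps c_gt0 pp i); congr (place c _ i).
  by apply/funext => j; rewrite ffunE.
rewrite card_in_imset; last first.
  move=> [t phi] [t' phi']; rewrite !inE /= => phi0 phi0' e.
  have e' i : blocks_of t (place c (fun i => phi i)) i =
              blocks_of t' (place c (fun i => phi' i)) i.
    by have := congr1 (fun x : {ffun _ -> _} => x i) e; rewrite !ffunE.
  have tt : t = t'.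
    have := e' i0; rewrite /blocks_of !place0 ?inE// => /addIr; exact.
  congr (_, _) => //; apply/ffunP => i; apply: val_inj => /=.
  rewrite -(gaps_place c_gt0 (fun i => phi i : nat) i).
  rewrite -(gaps_place c_gt0 (fun i => phi' i : nat) i).
  congr (gaps c _ i); apply/funext => j.
  have := e' j; rewrite /blocks_of tt !(natrD _ (shi_m c j)) => /addrI/addrI/(congr1 val) /=.
  (* All placements lie below q, so congruent ones are equal. *)
  by rewrite !val_Zp_nat// !modn_small// ?(leq_ltn_trans (leq_addr _ _) (placeq _ j)).
rewrite cardsX cardsT card_ord Zp_cast//; congr (_ * _)%N.
transitivity #|pffun_on (ord0 : 'I_G.+1) (predC1 i0) predT|; last first.
  by rewrite card_pffun_on card_ord cardC1 card_ord.
apply: eq_card => phi; rewrite inE; apply/eqP/pffun_onP => [phi0|[/fintype.subsetP sup _]].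
  split; last by move=> ? _.
  by apply/fintype.subsetP => i; rewrite !inE; apply: contra => /eqP ->; rewrite phi0.
by apply/eqP; apply: contraT => phi0; have := sup i0 phi0; rewrite !inE eqxx.
Qed.
End ModularCount.

Theorem theorem7 (R : realType) (n : nat) (c : 'I_n -> nat)
    (n_gt0 : (0 < n)%N) (c_gt0 : forall i, (0 < c i)%N) :
  let C := (\sum_(i < n) c i)%N in
  char_polynomial (shi_arrangement R c) = 'X * ('X - C%:R%:P) ^+ n.-1 /\
  (regions (shi_arrangement R c) #= `I_((1 + C) ^ n.-1)%N)%card.
Proof.
move=> C; pose S := shi_constraints c; pose g0 (_ : 'I_n) : int := 0.
(* With every index its own root and no shift, the flat is the whole space. *)
have fg : rooted (@id 'I_n) g0 by [].
have all_root : #|root_nodes (@id 'I_n)| = n.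
  by rewrite -[RHS]card_ord; apply: eq_card => l; rewrite !inE eqxx.
have flatT : potential_flat (@id 'I_n) g0 = [set: 'rV[R]_n].
  by apply/seteqP; split=> // x _; apply/forallP => l; rewrite addr0.
have chiE : char_polynomial (shi_arrangement R c) =
    delres (@monomial_dim R n) setT (map (@hyp R n) S).
  exact: char_polynomial_delres (@shi_arrangementE n c R) (@setT_shi_arrangement n c R).
have chi : char_polynomial (shi_arrangement R c) = 'X * ('X - C%:R%:P) ^+ n.-1.
  have [q0] := @delres_count R n S _ _ fg; rewrite flatT -chiE => q0P.
  apply/eqP; rewrite -subr_eq0; set D := _ - _.
  (* The difference [D] would vanish at [size D] distinct integers beyond [q0], too many roots for a
     nonzero polynomial. *)
  apply: contraT => D0; pose qs := [seq (C + (q0 + k).+1)%:Z | k <- iota 0 (size D)].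
  have : (size qs < size D)%N.
    apply: max_poly_roots => //; last first.
      by rewrite map_inj_uniq ?iota_uniq// => k l []; lia.
    apply/allP => _ /mapP[k _ ->]; apply/rootP.
    rewrite /D hornerD hornerN hornerM hornerX horner_exp hornerXsubC q0P; last 2 first.
    - by lia.
    - by have := c_gt0 (Ordinal n_gt0); rewrite /C (bigD1 (Ordinal n_gt0))//=; lia.
    apply/eqP; rewrite subr_eq0; apply/eqP.
    rewrite (_ : #|_| =
      #|[set x : {ffun 'I_n -> 'Z_(C + (q0 + k).+1)} | avoids S x]%SET|); last first.
      apply: eq_card => x; rewrite !inE (_ : potential _ _ _ = true)//.
      by apply/forallP => l; rewrite addr0.
    rewrite (@card_avoids n c c_gt0 (Ordinal n_gt0) erefl (q0 + k)).
    by rewrite PoszM; congr (_ * _); rewrite -natz natrX natz; congr (_ ^+ _); lia.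
  by rewrite size_map size_iota ltnn.
split=> //; suff <- : size (cells (@setT 'rV[R]_n) S) = ((1 + C) ^ n.-1)%N.
  exact/card_regions/shi_arrangementE.
(* At -1 the polynomial is -(-1 - C)^(n-1), and the sign (-1)^n turns it into (1 + C)^(n-1). *)
have := size_cells_delres R S fg; rewrite flatT -chiE chi all_root.
rewrite hornerM hornerX horner_exp hornerXsubC => e; apply/eqP; rewrite -eqz_nat.
apply/eqP; rewrite e -natz natrX.
have -> : (-1 - C%:R : int) = (-1) * (1 + C)%:R by rewrite natrD; ring.
rewrite exprMn (_ : (-1) ^+ n = -1 * (-1) ^+ n.-1); last by rewrite -exprS prednK.
by rewrite mulrACA mulrNN mulr1 mul1r mulrA -exprMn mulrNN mulr1 expr1n mul1r.
Qed.
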